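(* Algorithm Online_SumCj (described in the context) is 2-competitive for the online problem $1|jrp,s=1,p_j=1,r_j|\sum C_j+c_\mathcal{Q}$; that is, on every instance the cost of the solution it produces is at most twice the optimal offline cost.
   Context: Problem $1|jrp,s=1,p_j=1,r_j|\sum C_j+c_\mathcal{Q}$: jobs with processing time $1$ and nonnegative integer release dates $r_j$ must be processed non-preemptively on a single machine (at most one job at a time). There is a single resource, required by every job; each replenishment of it costs $K:=K_0+K_1\ge0$. A solution consists of start times $S_j$ (completion times $C_j=S_j+1$) and replenishment times $t_1<\dots<t_q$; it is feasible if no two jobs overlap and for each job $j$ some replenishment time lies in $[r_j,S_j]$. Its cost is $\sum_jC_j+qK$. Online setting: jobs are not known in advance (neither their number nor their data); a job becomes known at its release date. Time proceeds in integer steps; at each time $t$ the algorithm first learns the jobs released at $t$, then decides whether to replenish at $t$, then may start jobs; decisions cannot be revoked. An online algorithm is $c$-competitive if on every instance its cost is at most $c$ times the optimal offline cost. Let $G(a)=a(a+1)/2$. Algorithm Online_SumCj: start with $t:=0$. Repeat: let $B_t$ be the set of jobs released by time $t$ that are not yet scheduled; if $t\cdot|B_t|+G(|B_t|)\ge K$, then replenish the resource at $t$, start the jobs of $B_t$ consecutively from time $t$ without idle time in increasing release date order, and set $t:=t+|B_t|$; otherwise set $t:=t+1$.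
   Formalization: The algorithm replenishes at t only if B_t is nonempty; this is automatic for K > 0, but for K = 0 the literal loop would replenish with B_t empty, set t := t + 0 and never advance, producing no solution. *)

(* Defs.v *)
From mathcomp Require Import all_boot all_order all_algebra.
From mathcomp Require Import classical_sets reals.

Set Implicit Arguments.
Unset Strict Implicit.
Unset Printing Implicit Defensive.

Import Order.TTheory GRing.Theory Num.Theory.
Local Open Scope ring_scope.

(* [repl_cost] is K = K_0 + K_1; only the sum enters the problem. *)
Record instance (R : realType) := Instance {
  njobs : nat;
  release : 'I_njobs -> nat;
  repl_cost : R;
  repl_cost_ge0 : 0 <= repl_cost }.

Notation job I := 'I_(njobs I).

(* Offline solutions may use arbitrary real times. *)
Record solution (R : realType) (I : instance R) := Solution {
  start : job I -> R;
  repl_times : seq R }.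

Definition feasible (R : realType) (I : instance R) (s : solution I) : Prop :=
  [/\ sorted <%R (repl_times s),
      forall i j : job I, i != j ->
        start s i + 1 <= start s j \/ start s j + 1 <= start s i
    & forall j : job I, exists2 t : R, t \in repl_times s
        & (release j)%:R <= t <= start s j].

Definition cost (R : realType) (I : instance R) (s : solution I) : R :=
  \sum_(j : job I) (start s j + 1)
  + (size (repl_times s))%:R * repl_cost I.

Definition opt_cost (R : realType) (I : instance R) : R :=
  inf [set cost s | s in [set s : solution I | feasible s]]%classic.

(* An algorithm is given by the relation "on instance I it produces s". *)
Definition competitive (R : realType) (c : R)
    (alg : forall I : instance R, solution I -> Prop) : Prop :=
  forall I : instance R,
    (exists s, alg I s) /\
    (forall s, alg I s -> feasible s /\ cost s <= c * opt_cost I).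

Definition G (R : realType) (a : nat) : R := a%:R * (a%:R + 1) / 2.

Record state (R : realType) (I : instance R) := State {
  now : nat;
  started : job I -> option nat;
  repls : seq nat }.

Definition init (R : realType) (I : instance R) : state I :=
  @State R I 0%N (fun=> None) [::].

(* The set B_t for t = now st. *)
Definition pending (R : realType) (I : instance R) (st : state I) :
    {set job I} :=
  [set j : job I | (release j <= now st)%N && (started st j == None)].

(* The order in which the jobs of a batch are started: by nondecreasing release
   date, ties being broken arbitrarily. *)
Definition release_order (R : realType) (I : instance R)
    (ord : {set job I} -> seq (job I)) : Prop :=
  forall B : {set job I},
    perm_eq (ord B) (enum B) /\
    sorted (fun i j : job I => (release i <= release j)%N) (ord B).

(* The test [0 < #|B|] follows from the other one when K > 0; for K = 0 it
   prevents the loop from replenishing forever at the same t with B_t empty. *)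
Definition step (R : realType) (I : instance R)
    (ord : {set job I} -> seq (job I)) (st : state I) : state I :=
  let t := now st in
  let B := pending st in
  if (0 < #|B|)%N && (repl_cost I <= t%:R * #|B|%:R + G R #|B|) then
    State (t + #|B|)%N
      (fun j => if j \in B then Some (t + index j (ord B))%N else started st j)
      (rcons (repls st) t)
  else State t.+1 (started st) (repls st).

Definition run (R : realType) (I : instance R)
    (ord : {set job I} -> seq (job I)) (k : nat) : state I :=
  iter k (step ord) (init I).

(* Once every job has been started, further iterations change only [now]. *)
Definition Online_SumCj (R : realType)
    (ord : forall I : instance R, {set job I} -> seq (job I))
    (I : instance R) (s : solution I) : Prop :=
  exists k : nat,
    [/\ forall j : job I, exists2 m : nat,
          started (run (ord I) k) j = Some m & start s j = m%:R
      & repl_times s = [seq t%:R | t <- repls (run (ord I) k)]].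

(* Main.v *)
Require Import Defs.
From mathcomp Require Import boolp classical_sets reals.
From mathcomp Require Import all_boot all_order all_algebra.
From mathcomp Require Import ring lra.

(** Fix a feasible solution [s].  Every batch of the algorithm has total
    completion time at least [K].  Call a batch started at [t] early if one of
    its jobs starts before [t] in [s], and late otherwise.  For an early batch,
    [s] replenishes after the previous replenishment of the algorithm and
    before [t], and this [K] is charged to the batch.  Split a maximal period
    in which the machine is busy at its first late batch.  From that batch on
    the algorithm is optimal for the sum of completion times, hence its cost is
    at most twice that of [s].  The batches before it, started at [a], behave
    like one batch of [m + n] jobs, [m] of which were already pending at
    [a - 1]: since the algorithm waited at [a - 1], the excess of its
    completion times over twice those of [s] is at most [K].  The proof carries
    this accounting along the run of the algorithm as an invariant. *)

Set Implicit Arguments.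
Unset Strict Implicit.
Unset Printing Implicit Defensive.

Import Order.TTheory GRing.Theory Num.Theory.
Local Open Scope ring_scope.

Lemma ltn_count (T : eqType) (p q : pred T) (x : T) (s : seq T) :
  subpred p q -> x \in s -> ~~ p x -> q x -> (count p s < count q s)%N.
Proof.
move=> sub_pq xs /negPf px qx.
by rewrite !(permP (perm_to_rem xs)) /= px qx ltnS sub_count.
Qed.

Lemma map_index_iota (T : eqType) (s : seq T) :
  uniq s -> [seq index x s | x <- s] = iota 0 (size s).
Proof.
case: s => // x0 s uniq_s; apply: (@eq_from_nth _ 0%N).
  by rewrite size_map size_iota.
move=> i; rewrite size_map => lt_is.
by rewrite (nth_map x0) // index_uniq // nth_iota.
Qed.

Lemma big_setU_disjoint (V : Type) (idx : V) (op : Monoid.com_law idx)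
    (T : finType) (A B : {set T}) (F : T -> V) :
  [disjoint A & B] ->
  \big[op/idx]_(i in A :|: B) F i
  = op (\big[op/idx]_(i in A) F i) (\big[op/idx]_(i in B) F i).
Proof.
by move=> disjAB; rewrite -bigU //; apply: eq_bigl => i; rewrite inE.
Qed.

Section BatchCost.

Variable R : realType.
Implicit Types (a : R) (m n : nat).

Definition batch_cost a n : R := a * n%:R + G R n.

Lemma batch_costn0 a : batch_cost a 0 = 0.
Proof. by rewrite /batch_cost /G mulr0 !mul0r addr0. Qed.

Lemma batch_costn1 a : batch_cost a 1 = a + 1.
Proof. by rewrite /batch_cost /G; field. Qed.

Lemma batch_costD a m n :
  batch_cost a (m + n) = batch_cost a m + batch_cost (a + m%:R) n.
Proof. by rewrite /batch_cost /G natrD; field. Qed.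

Lemma batch_cost_sum a n :
  batch_cost a n = \sum_(0 <= i < n) (a + i%:R + 1).
Proof.
elim: n => [|n IHn]; first by rewrite big_geq // batch_costn0.
by rewrite big_nat_recr //= -IHn -addn1 batch_costD batch_costn1.
Qed.

Lemma le_batch_cost a n : 0 <= a -> (0 < n)%N -> a <= batch_cost a n.
Proof.
move=> a_ge0 n_gt0; rewrite -[leLHS]addr0 lerD //.
  by rewrite ler_peMr ?ler1n.
by rewrite divr_ge0 ?mulr_ge0 ?addr_ge0.
Qed.

Lemma batch_cost_le_completions (T : finType) (S : T -> R) (A : {set T}) a :
    {in A &, forall i j, i != j -> S i + 1 <= S j \/ S j + 1 <= S i} ->
    {in A, forall j, a <= S j} ->
  batch_cost a #|A| <= \sum_(j in A) (S j + 1).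
Proof.
move: {2}#|A| (erefl #|A|) => n.
elim: n A a => [|n IHn] A a cardA apartA leaS.
  by rewrite (cards0_eq cardA) cards0 big_set0 batch_costn0.
have /card_gt0P[j0 j0A] : (0 < #|A|)%N by rewrite cardA.
have [j jA first_j] : exists2 j, j \in A & {in A, forall i, S j <= S i}.
  by case: (arg_minP S j0A) => j; exists j.
have cardDj : #|A :\ j| = n by have := cardsD1 j A; rewrite jA cardA => -[].
have rest_le : batch_cost (a + 1) #|A :\ j| <= \sum_(i in A :\ j) (S i + 1).
  apply: IHn => // [|i /setD1P[neq_ij iA]].
    by apply: sub_in2 apartA => i /setD1P[].
  have := leaS j jA; have := first_j i iA.
  by case: (apartA i j iA jA neq_ij) => *; lra.
have le_aj := leaS j jA.
rewrite (big_setD1 j) //= (cardsD1 j) jA batch_costD batch_costn1 lerD //.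
by rewrite lerD2r.
Qed.

Lemma batch_costD_le_double a m n :
  0 <= a ->
  batch_cost a (m + n)
  <= 2 * (batch_cost 0 m + batch_cost a n) + batch_cost (a - 1) m.
Proof.
move=> a_ge0; rewrite -subr_ge0.
have -> : 2 * (batch_cost 0 m + batch_cost a n) + batch_cost (a - 1) m
            - batch_cost a (m + n)
          = a * n%:R + ((n%:R - m%:R) ^+ 2 + m%:R ^+ 2 + n%:R) / 2.
  by rewrite /batch_cost /G natrD; field.
apply: addr_ge0; first by rewrite mulr_ge0.
by rewrite divr_ge0 // !addr_ge0 ?sqr_ge0.
Qed.

End BatchCost.

Section Algorithm.

Variables (R : realType) (I : instance R) (ord : {set job I} -> seq (job I)).
Hypothesis ord_perm : forall B, perm_eq (ord B) (enum B).
Implicit Types (st : state I) (j : job I).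

Definition served st : {set job I} := [set j | started st j != None].

Definition served_at st j : nat := odflt 0%N (started st j).

Definition alg_cost st : R :=
  \sum_(j in served st) ((served_at st j)%:R + 1)
  + (size (repls st))%:R * repl_cost I.

Definition fires st : bool :=
  (0 < #|pending st|)%N
  && (repl_cost I <= batch_cost (now st)%:R #|pending st|).

Definition serve st : state I :=
  let B := pending st in
  State (now st + #|B|)%N
    (fun j => if j \in B then Some (now st + index j (ord B))%N
              else started st j)
    (rcons (repls st) (now st)).

Definition wait st : state I := State (now st).+1 (started st) (repls st).

Lemma stepE st : step ord st = if fires st then serve st else wait st.
Proof. by []. Qed.

Lemma in_pending st j :
  (j \in pending st) = (release j <= now st)%N && (j \notin served st).
Proof. by rewrite !inE negbK. Qed.

Lemma disjoint_served_pending st : [disjoint served st & pending st].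
Proof.
rewrite disjoint_subset; apply/subsetP => j js.
by rewrite inE in_pending js andbF.
Qed.

Lemma served_serve st : served (serve st) = served st :|: pending st.
Proof.
apply/setP => j; rewrite in_setU in_set [in RHS]in_set /= orbC.
by case: ifP.
Qed.

Lemma unserved_serve st j :
  (j \in ~: served (serve st)) =
  (now st < release j)%N && (j \in ~: served st).
Proof.
rewrite served_serve setCU in_setI [in X in _ && X]in_setC in_pending -in_setC.
by rewrite negb_and -ltnNge andbC; case: (j \in ~: _); rewrite ?andbF ?orbF.
Qed.

Lemma served_at_serve st j : j \in served st ->
  served_at (serve st) j = served_at st j.
Proof.
by move=> js; rewrite /served_at /= (disjointFr (disjoint_served_pending st)).
Qed.

Lemma pending_at_serve st j : j \in pending st ->
  served_at (serve st) j = (now st + index j (ord (pending st)))%N.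
Proof. by move=> jB; rewrite /served_at /= jB. Qed.

Lemma mem_ord (B : {set job I}) : ord B =i B.
Proof. by move=> j; rewrite (perm_mem (ord_perm B)) mem_enum. Qed.

Lemma size_ord (B : {set job I}) : size (ord B) = #|B|.
Proof. by rewrite (perm_size (ord_perm B)) cardE. Qed.

Lemma sum_index_ord (V : nmodType) (F : nat -> V) (B : {set job I}) :
  \sum_(j in B) F (index j (ord B)) = \sum_(0 <= i < #|B|) F i.
Proof.
rewrite -big_enum /= -(perm_big _ (ord_perm B)) /=.
rewrite -(big_map (index^~ (ord B)) xpredT F) map_index_iota; last first.
  by rewrite (perm_uniq (ord_perm B)) enum_uniq.
by rewrite size_ord /index_iota subn0.
Qed.

Lemma alg_cost_serve st :
  alg_cost (serve st)
  = alg_cost st + batch_cost (now st)%:R #|pending st| + repl_cost I.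
Proof.
rewrite /alg_cost served_serve big_setU_disjoint ?disjoint_served_pending //=.
under eq_bigr => j js do rewrite served_at_serve //.
have -> : \sum_(j in pending st) ((served_at (serve st) j)%:R + 1)
          = batch_cost (now st)%:R #|pending st| :> R.
  rewrite batch_cost_sum -sum_index_ord.
  by apply: eq_bigr => j jB; rewrite pending_at_serve // natrD.
by rewrite size_rcons -natr1; ring.
Qed.

Record valid_state st : Prop := ValidState {
  repls_sorted : sorted ltn (repls st);
  repls_lt_now : {in repls st, forall t, (t < now st)%N};
  repls_lt_release :
    {in repls st & ~: served st, forall t j, (t < release j)%N};
  served_lt_now : {in served st, forall j, (served_at st j < now st)%N};
  served_supplied : {in served st, forall j,
    exists2 t, t \in repls st & (release j <= t <= served_at st j)%N};
  served_at_inj : {in served st &, injective (served_at st)} }.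

Lemma valid_init : valid_state (init I).
Proof. by split=> // j; rewrite inE. Qed.

Lemma valid_wait st : valid_state st -> valid_state (wait st).
Proof.
case=> sorted_repls lt_now lt_release served_lt supplied inj.
split=> //= [t ts|j sj]; first exact: ltnW (lt_now t ts).
exact: ltnW (served_lt j sj).
Qed.

Lemma served_at_serve_inj st : valid_state st ->
  {in served (serve st) &, injective (served_at (serve st))}.
Proof.
move=> vst; have old_neq_new i j : i \in served st -> j \in pending st ->
    served_at (serve st) i != served_at (serve st) j.
  move=> si pj; rewrite served_at_serve // pending_at_serve // ltn_eqF //.
  exact: leq_trans (served_lt_now vst si) (leq_addr _ _).
move=> i j; rewrite served_serve => /setUP[si|pi] /setUP[sj|pj] eq_at.
- by move: eq_at; rewrite !served_at_serve //; apply: served_at_inj.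
- by have := old_neq_new i j si pj; rewrite eq_at eqxx.
- by have := old_neq_new j i sj pi; rewrite eq_at eqxx.
- move: eq_at; rewrite !pending_at_serve // => /addnI.
  by apply: (index_inj i); rewrite mem_ord.
Qed.

Lemma valid_serve st :
  (0 < #|pending st|)%N -> valid_state st -> valid_state (serve st).
Proof.
move=> B_gt0 vst; split; last exact: served_at_serve_inj.
- move: (repls_sorted vst) (repls_lt_now vst) => /=.
  case: (repls st) => //= t T sorted_T lt_now.
  by rewrite rcons_path sorted_T; apply/lt_now/mem_last.
- move=> t; rewrite mem_rcons inE /= => /predU1P[->|ts].
    by rewrite -addn1 leq_add2l.
  exact: ltn_addr (repls_lt_now vst ts).
- move=> t j; rewrite mem_rcons unserved_serve inE => t_repl /andP[lt_now uj].
  by case/predU1P: t_repl => [->|ts] //; apply: repls_lt_release uj.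
- move=> j; rewrite served_serve => /setUP[sj|pj].
    by rewrite served_at_serve // ltn_addr // served_lt_now.
  by rewrite pending_at_serve //= ltn_add2l -size_ord index_mem mem_ord.
- move=> j; rewrite served_serve => /setUP[sj|pj].
    rewrite served_at_serve //; have [t ts rel_t] := served_supplied vst sj.
    by exists t => //; rewrite mem_rcons inE ts orbT.
  exists (now st); first by rewrite mem_rcons mem_head.
  by rewrite pending_at_serve // leq_addr andbT; case/setIdP: pj.
Qed.

Lemma valid_step st : valid_state st -> valid_state (step ord st).
Proof.
by rewrite stepE; case: ifP => [/andP[B_gt0 _]|_];
  [apply: valid_serve | apply: valid_wait].
Qed.

Lemma valid_run (k : nat) : valid_state (run ord k).
Proof. by elim: k => [|k IHk]; [apply: valid_init | apply: valid_step]. Qed.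

Lemma leq_now_run (k : nat) : (k <= now (run ord k))%N.
Proof.
elim: k => //= k IHk; rewrite -/(run ord k) stepE.
by case: ifP => [/andP[B_gt0 _]|//] /=; rewrite -[k.+1]addn1 leq_add.
Qed.

Lemma step_serves_all st :
    repl_cost I <= (now st)%:R -> (forall j, (release j <= now st)%N) ->
  served (step ord st) = setT.
Proof.
move=> le_now released; rewrite stepE.
have pendingE : pending st = ~: served st.
  by apply/setP => j; rewrite in_pending released in_setC.
have [_|] := ifP; first by rewrite served_serve pendingE setUCr.
rewrite /fires; have [|B_gt0] := posnP #|pending st|.
  by move/cards0_eq=> no_pending _; rewrite -setC0 -no_pending pendingE setCK.
by rewrite (le_trans le_now) ?le_batch_cost.
Qed.

Lemma run_serves_all : exists k, served (run ord k) = setT.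
Proof.
pose n := Num.bound (repl_cost I).
have le_n : repl_cost I <= n%:R := ltW (archi_boundP (repl_cost_ge0 I)).
pose k := (n + \max_(j : job I) release j)%N; exists k.+1.
have le_now : (k <= now (run ord k))%N := leq_now_run k.
apply: step_serves_all => [|j].
  by apply: le_trans le_n _; rewrite ler_nat (leq_trans _ le_now) ?leq_addr.
apply: leq_trans le_now; apply: leq_trans (leq_addl n _).
exact: leq_bigmax.
Qed.

Definition schedule st : solution I :=
  Solution (fun j => (served_at st j)%:R) [seq t%:R | t <- repls st].

Lemma cost_schedule st : served st = setT -> cost (schedule st) = alg_cost st.
Proof.
move=> all_served; rewrite /cost /alg_cost all_served size_map.
by congr (_ + _); apply: eq_bigl => j; rewrite inE.
Qed.

Lemma feasible_schedule st :
  valid_state st -> served st = setT -> feasible (schedule st).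
Proof.
move=> vst all_served.
have served_st j : j \in served st by rewrite all_served inE.
split=> [|i j neq_ij|j].
- by rewrite (mono_sorted (ltr_nat R)) repls_sorted.
- rewrite !natr1 !ler_nat; apply/orP; rewrite -neq_ltn.
  by apply: contra_neq neq_ij; apply: served_at_inj.
- have [t ts rel_t] := served_supplied vst (served_st j).
  by exists t%:R; rewrite ?map_f // !ler_nat.
Qed.

End Algorithm.

Lemma Online_SumCjP (R : realType)
    (ord : forall I : instance R, {set job I} -> seq (job I))
    (I : instance R) (s : solution I) :
  Online_SumCj ord s <->
  exists2 k, served (run (ord I) k) = setT & s = schedule (run (ord I) k).
Proof.
split=> [[k [start_s repl_s]]|[k all_served ->]]; exists k.
- by apply/setP => j; have [m started_j _] := start_s j; rewrite !inE started_j.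
- case: s start_s repl_s => S T /= start_S ->; congr Solution.
  by apply/funext => j; have [m] := start_S j; rewrite /served_at => -> ->.
- split=> // j; have: j \in served (run (ord I) k) by rewrite all_served inE.
  by rewrite inE /= /served_at; case: (started _ j) => // m _; exists m.
Qed.

Section Amortization.

Variables (R : realType) (I : instance R) (ord : {set job I} -> seq (job I)).
Hypothesis ord_perm : forall B, perm_eq (ord B) (enum B).
Variable s : solution I.
Hypothesis s_feasible : feasible s.
Implicit Types (st : state I) (A D : {set job I}) (a : nat) (j : job I).

Lemma start_ge a j : (a <= release j)%N -> a%:R <= start s j.
Proof.
rewrite -(ler_nat R) => /le_trans; apply.
by have [_ _ /(_ j)[t _ /andP[]]] := s_feasible; apply: le_trans.
Qed.

Definition completions A : R := \sum_(j in A) (start s j + 1).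

Lemma completionsU A D :
  [disjoint A & D] -> completions (A :|: D) = completions A + completions D.
Proof. exact: big_setU_disjoint. Qed.

Lemma completions_ge (a : R) A :
  {in A, forall j, a <= start s j} -> batch_cost a #|A| <= completions A.
Proof.
by move=> le_a; apply: batch_cost_le_completions => // i j _ _;
  have [_ + _] := s_feasible; apply.
Qed.

Definition precedes_repl st (t : R) : bool :=
  has (fun r => t <= r%:R) (repls st).

Definition preceding_repls st : nat :=
  count (precedes_repl st) (repl_times s).

Definition early st : bool :=
  [exists j in pending st, start s j < (now st)%:R].

Lemma preceding_repls_serve st :
  valid_state st ->
  (preceding_repls st + early st <= preceding_repls (serve ord st))%N.
Proof.
move=> vst.
have precedes_serve :
    subpred (precedes_repl st) (precedes_repl (serve ord st)).
  by move=> t; rewrite /precedes_repl has_rcons orbC => ->.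
case earlyE: (early st); last by rewrite addn0 sub_count.
have /existsP[j /andP[jB lt_now]] := earlyE.
have [_ _ /(_ j)[t ts /andP[rel_t le_start]]] := s_feasible.
rewrite addn1; apply: (ltn_count precedes_serve ts).
- rewrite -all_predC; apply/allP => r r_repl /=; rewrite -ltNge.
  apply: lt_le_trans rel_t; rewrite ltr_nat (repls_lt_release vst r_repl) //.
  by move: jB; rewrite in_pending in_setC => /andP[].
- by rewrite /precedes_repl has_rcons (ltW (le_lt_trans le_start lt_now)).
Qed.

Definition slack st : R :=
  2 * completions (served st) + 2 * (preceding_repls st)%:R * repl_cost I
  - alg_cost st.

Lemma slack_serve st :
  valid_state st ->
  slack st + 2 * completions (pending st) + 2 * (early st)%:R * repl_cost I
    - batch_cost (now st)%:R #|pending st| - repl_cost I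
  <= slack (serve ord st).
Proof.
move=> vst; rewrite /slack alg_cost_serve // served_serve.
rewrite completionsU ?disjoint_served_pending //.
have credit : ((preceding_repls st)%:R + (early st)%:R) * repl_cost I
    <= (preceding_repls (serve ord st))%:R * repl_cost I.
  by rewrite -natrD ler_wpM2r ?repl_cost_ge0 // ler_nat preceding_repls_serve.
lra.
Qed.

Definition busy_since a D st : Prop :=
  [/\ D \subset served st, now st = (a + #|D|)%N
    & {in ~: served st, forall j, (a <= release j)%N}].

Lemma busy_since_now st : busy_since (now st) (pending st) (serve ord st).
Proof.
split=> //; first by rewrite served_serve subsetUr.
by move=> j; rewrite unserved_serve => /andP[/ltnW].
Qed.

Lemma disjoint_busy_pending a D st :
  busy_since a D st -> [disjoint D & pending st].
Proof.
by case=> subD _ _; apply: disjointWl subD (disjoint_served_pending st).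
Qed.

Lemma busy_le_release a D st :
  busy_since a D st -> {in pending st, forall j, (a <= release j)%N}.
Proof.
case=> _ _ le_rel j; rewrite in_pending -in_setC => /andP[_ uj].
exact: le_rel.
Qed.

Lemma card_busyU a D st :
  busy_since a D st -> #|D :|: pending st| = (#|D| + #|pending st|)%N.
Proof.
by move=> /disjoint_busy_pending disjDB; apply/eqP; rewrite leq_card_setU.
Qed.

Lemma batch_cost_busyU a D st :
  busy_since a D st ->
  batch_cost a%:R #|D :|: pending st|
  = batch_cost a%:R #|D| + batch_cost (now st)%:R #|pending st| :> R.
Proof.
move=> busy; rewrite (card_busyU busy) batch_costD -natrD.
by have [_ <- _] := busy.
Qed.

Lemma busy_since_serve a D st :
  busy_since a D st -> busy_since a (D :|: pending st) (serve ord st).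
Proof.
move=> busy; have [subD nowE le_rel] := busy; split.
- by rewrite served_serve setSU.
- by rewrite (card_busyU busy) /= nowE addnA.
- by move=> j; rewrite unserved_serve => /andP[_ /le_rel].
Qed.

Definition backlog a D : {set job I} := [set j in D | (release j < a)%N].

(* The machine has been busy since a late batch started at [a]. *)
Definition late_busy st : Prop :=
  exists a D, [/\ busy_since a D st, {in D, forall j, a%:R <= start s j}
    & 2 * completions D - 2 * batch_cost a%:R #|D| <= slack st].

(* The machine has been busy since [a], with early batches only; the bound on
   the backlog records that the algorithm waited at [a - 1]. *)
Definition early_busy st : Prop :=
  exists a D, [/\ busy_since a D st,
    batch_cost (a%:R - 1) #|backlog a D| <= repl_cost I
    & 2 * completions D + repl_cost I - batch_cost a%:R #|D| <= slack st].

Definition waiting st : Prop :=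
  0 <= slack st /\
  batch_cost ((now st)%:R - 1) #|backlog (now st) (pending st)| <= repl_cost I.

Lemma slack_late_busy st : late_busy st -> 0 <= slack st.
Proof. by move=> [a [D [_ /completions_ge le_a]]]; lra. Qed.

Lemma slack_early_busy st : early_busy st -> 0 <= slack st.
Proof.
move=> [a [D [_ backlog_le slack_ge]]]; set W := backlog a D in backlog_le.
have WD : D :&: W = W by apply/setIidPr/subsetP => j /setIdP[].
have start_W : {in W, forall j, 0 <= start s j}.
  by move=> j _; apply: start_ge (leq0n _).
have start_DW : {in D :\: W, forall j, a%:R <= start s j}.
  by move=> j; rewrite !inE => /andP[+ jD]; rewrite jD -leqNgt => /start_ge.
have complD : completions D = completions W + completions (D :\: W).
  by rewrite /completions (big_setID W) WD.
have cardD : #|D| = (#|W| + #|D :\: W|)%N by rewrite -(cardsID W D) WD.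
have := batch_costD_le_double #|W| #|D :\: W| (ler0n R a).
have := completions_ge start_W; have := completions_ge start_DW.
by move: slack_ge; rewrite complD cardD; lra.
Qed.

Lemma late_busy_serve st :
  valid_state st -> fires st -> late_busy st -> late_busy (serve ord st).
Proof.
move=> vst /andP[_ le_batch] [a [D [busy le_start slack_ge]]].
exists a, (D :|: pending st); split; first exact: (busy_since_serve busy).
  by move=> j /setUP[/le_start //|/(busy_le_release busy)/start_ge].
rewrite (batch_cost_busyU busy) (completionsU (disjoint_busy_pending busy)).
have credit_ge0 : 0 <= (early st)%:R * repl_cost I.
  by rewrite mulr_ge0 ?repl_cost_ge0.
by have := slack_serve vst; lra.
Qed.

Lemma late_busy_serve_late st :
  valid_state st -> fires st -> ~~ early st -> 0 <= slack st ->
  late_busy (serve ord st).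
Proof.
move=> vst /andP[_ le_batch] late slack_ge0.
exists (now st), (pending st); split; first exact: busy_since_now.
  move=> j jB; rewrite leNgt; apply: contra late => lt_now.
  by apply/existsP; exists j; rewrite jB.
by have := slack_serve vst; rewrite (negPf late) /=; lra.
Qed.

Lemma early_busy_serve st :
  valid_state st -> early st -> early_busy st -> early_busy (serve ord st).
Proof.
move=> vst early_st [a [D [busy backlog_le slack_ge]]].
have backlogU : backlog a (D :|: pending st) = backlog a D.
  apply/setP => j; rewrite [LHS]in_set [RHS]in_set in_setU.
  have [jB|_] := boolP (j \in pending st); last by rewrite orbF.
  by rewrite ltnNge (busy_le_release busy jB) !andbF.
exists a, (D :|: pending st); rewrite backlogU; split=> //.
  exact: (busy_since_serve busy).
rewrite (batch_cost_busyU busy) (completionsU (disjoint_busy_pending busy)).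
have := slack_serve vst; have := repl_cost_ge0 I.
by rewrite early_st /=; lra.
Qed.

Lemma early_busy_serve_waiting st :
  valid_state st -> early st -> waiting st -> early_busy (serve ord st).
Proof.
move=> vst early_st [slack_ge0 backlog_le].
exists (now st), (pending st); split=> //; first exact: busy_since_now.
by have := slack_serve vst; rewrite early_st /=; lra.
Qed.

Lemma waiting_wait st : ~~ fires st -> 0 <= slack st -> waiting (wait st).
Proof.
move=> not_fires slack_ge0; split=> //=; rewrite -natr1 addrK.
have -> : backlog (now st).+1 (pending (wait st)) = pending st.
  apply/setP => j; rewrite in_set !in_pending /= ltnS andbC andbA.
  by congr (_ && _); apply/andb_idr/leqW.
move: not_fires; rewrite negb_and -leqNgt leqn0 -ltNge => /orP[/eqP ->|/ltW //].
by rewrite batch_costn0 repl_cost_ge0.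
Qed.

Definition amortized st : Prop :=
  [\/ waiting st, early_busy st | late_busy st].

Lemma slack_amortized st : amortized st -> 0 <= slack st.
Proof.
by case=> [[]//| |]; [apply: slack_early_busy | apply: slack_late_busy].
Qed.

Lemma amortized_init : amortized (init I).
Proof.
have served0 : served (init I) = set0 by apply/setP => j; rewrite !inE.
have backlog0 : backlog 0 (pending (init I)) = set0.
  by apply/setP => j; rewrite !inE ltn0 andbF.
constructor 1; split; last first.
  by rewrite backlog0 cards0 batch_costn0 repl_cost_ge0.
rewrite /slack /alg_cost /completions served0 !big_set0 /= mulr0 mul0r addr0.
by rewrite subr0 add0r !mulr_ge0 ?repl_cost_ge0.
Qed.

Lemma amortized_step st :
  valid_state st -> amortized st -> amortized (step ord st).
Proof.
move=> vst am_st; have slack_ge0 := slack_amortized am_st.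
rewrite stepE; have [fires_st|not_fires] := boolP (fires st); last first.
  by constructor 1; apply: waiting_wait.
have [early_st|late_st] := boolP (early st); last first.
  by constructor 3; apply: late_busy_serve_late.
case: am_st => mode.
- by constructor 2; apply: early_busy_serve_waiting.
- by constructor 2; apply: early_busy_serve.
- by constructor 3; apply: late_busy_serve.
Qed.

Lemma amortized_run (k : nat) : amortized (run ord k).
Proof.
elim: k => [|k IHk]; first exact: amortized_init.
by apply: amortized_step => //; apply: valid_run.
Qed.

Lemma alg_cost_run_le (k : nat) : alg_cost (run ord k) <= 2 * cost s.
Proof.
have := slack_amortized (amortized_run k).
rewrite subr_ge0 => /le_trans; apply.
rewrite mulrDr -mulrA lerD // ler_pM2l //; last first.
  by rewrite ler_wpM2r ?repl_cost_ge0 // ler_nat count_size.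
rewrite /completions [leRHS](bigID (mem (served (run ord k)))) /= lerDl.
by apply: sumr_ge0 => j _; rewrite addr_ge0 // (start_ge (leq0n _)).
Qed.

End Amortization.

Lemma competitive_feasible_le (R : realType) (c : R)
    (alg : forall I : instance R, solution I -> Prop) :
    0 < c -> (forall I, exists s, alg I s) ->
    (forall I s, alg I s -> feasible s) ->
    (forall I (s s' : solution I),
      alg I s -> feasible s' -> cost s <= c * cost s') ->
  competitive c alg.
Proof.
move=> c_gt0 alg_total alg_feasible cost_le I; split=> // s alg_s.
have feasible_s := alg_feasible I s alg_s; split=> //.
rewrite mulrC -ler_pdivrMr //; apply: lb_le_inf; first by exists (cost s), s.
move=> _ [s' feasible_s' <-].
by rewrite ler_pdivrMr // mulrC; apply: cost_le.
Qed.

Theorem theorem10 (R : realType)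
    (ord : forall I : instance R, {set job I} -> seq (job I))
    (ord_release : forall I : instance R, release_order (ord I)) :
  competitive 2 (Online_SumCj ord).
Proof.
have ord_perm I B : perm_eq (ord I B) (enum B) := (ord_release I B).1.
apply: competitive_feasible_le => // [I|I s|I s s'].
- have [k all_served] := run_serves_all (ord I).
  by exists (schedule (run (ord I) k)); apply/Online_SumCjP; exists k.
- move=> /Online_SumCjP[k all_served ->].
  by apply: feasible_schedule => //; apply: valid_run.
- move=> /Online_SumCjP[k all_served ->] feasible_s'.
  by rewrite cost_schedule // alg_cost_run_le.
Qed.
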